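(* Let $T=(V,E)$ be a tree on a well ordered (totally ordered finite) set of variables $V$, $|V|=n$, and let $C=\prod_{x\in V}x^{w(x)+1}$ be a monomial of degree $n-1$, where $w(x)\in\{-1,0,1,2,\dots\}$ for every $x\in V$. Then the partial divided symmetrization $DS_T(C)$ equals $\operatorname{sign}(C)$ times the number of $C$-acceptable permutations of $V$.
   Context: Symmetrization: for a rational function $\varphi$ (with coefficients in some field) of the variables $V=\{x_1<x_2<\dots<x_n\}$, $\operatorname{Sym}\varphi=\sum_{\pi}\varphi(\pi_1,\dots,\pi_n)$, where the sum is over all $n!$ permutations $\pi$ of the variables. Partial divided symmetrization: for a graph $G=(V,E)$, view $E$ as a set of pairs $(x,y)\in V^2$ with $x<y$. For a polynomial $f$ in the variables $V$, $DS_G(f)=\operatorname{Sym}\left(\frac{f}{\prod_{(x,y)\in E}(x-y)}\right)$. This is a polynomial of degree at most $\deg f-|E|$; in particular it is a constant when $G$ is a tree on $n$ vertices and $\deg f=n-1$. Weights, regular and inversive edges: $w(x)$ is called the weight of the vertex $x$; since $\deg C=n-1$, the total weight of all vertices is $-1$. For each edge $e=(x,y)\in E$, $x<y$, consider the two connected components of $T\setminus e$ ($T$ with edge $e$ deleted). The total weight (sum of the weights of the vertices) is negative for exactly one of them. If this component contains $y$, the edge $e$ is called regular; otherwise it is called inversive. Sign: $\operatorname{sign}(C)=(-1)^{k}$, where $k$ is the number of inversive edges. Acceptable permutations: a permutation $\pi$ of the set $V$ is $C$-acceptable if for every edge $e=(x,y)\in E$, $x<y$, one has $\pi(x)<\pi(y)$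 if and only if $e$ is regular. *)

(* Defs.v *)
From HB Require Import structures.
From mathcomp Require Export all_boot all_order perm all_algebra.
From mathcomp Require Export mpoly.

Set Implicit Arguments.
Unset Strict Implicit.
Unset Printing Implicit Defensive.

Import Order.TTheory GRing.Theory Num.Theory.

Local Open Scope ring_scope.

Local Notation "x %:F" := (tofrac x).

(* The ordered vertex set x_1 < ... < x_n is 'I_n with its natural order; the
   variable attached to the vertex i is 'X_i. *)

Section Symmetrization.

Variables (F : fieldType) (n : nat).

(* phi(pi_1, ..., pi_n), computed on the numerator and the denominator of a
   representative of phi (msym s p substitutes 'X_(s i) for 'X_i in p);
   subst_frac_div shows that the representative does not matter. *)
Definition subst_frac (s : 'S_n) (phi : {fraction {mpoly F[n]}}) :
    {fraction {mpoly F[n]}} :=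
  (msym s \n_(repr phi))%:F / (msym s \d_(repr phi))%:F.

Definition Sym (phi : {fraction {mpoly F[n]}}) : {fraction {mpoly F[n]}} :=
  \sum_(s : 'S_n) subst_frac s phi.

Lemma frac_repr (phi : {fraction {mpoly F[n]}}) :
  phi = (\n_(repr phi))%:F / (\d_(repr phi))%:F.
Proof.
set r := repr phi.
have d0 : \d_r != 0 by exact: denom_ratioP.
have dF0 : (\d_r)%:F != 0 by rewrite tofrac_eq0.
apply: (mulIf dF0); rewrite mulfVK //.
have -> : phi = \pi_({fraction {mpoly F[n]}})%qT r by rewrite reprK.
rewrite ![tofrac _]piE -[LHS]FracField.pi_mul.
apply/eqP; rewrite FracField.equivf_def /FracField.equivf /FracField.mulf.
by rewrite !numden_Ratio ?oner_neq0 ?mulr1 // mulrC.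
Qed.

Lemma subst_frac_div (s : 'S_n) (p q : {mpoly F[n]}) : q != 0 ->
  subst_frac s (p%:F / q%:F) = (msym s p)%:F / (msym s q)%:F.
Proof.
move=> q0; have := frac_repr (p%:F / q%:F).
rewrite /subst_frac; set r := repr _.
have d0 : \d_r != 0 by exact: denom_ratioP.
have nz (u : {mpoly F[n]}) : u != 0 -> (msym s u)%:F != 0.
  by move=> u0; rewrite tofrac_eq0 (raddf_eq0 _ (@inj_msym _ _ s)).
move/eqP; rewrite eqr_div ?tofrac_eq0 // -!tofracM tofrac_eq => /eqP E.
by apply/eqP; rewrite eqr_div ?nz // -!tofracM -!msymM E.
Qed.

End Symmetrization.

Section Graph.

Variable n : nat.
Implicit Types (e : rel 'I_n) (w : 'I_n -> int).

Definition edges e : {set 'I_n * 'I_n} :=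
  [set p : 'I_n * 'I_n | (p.1 < p.2)%N && e p.1 p.2].

Definition is_tree e : Prop :=
  [/\ ssrbool.symmetric e, irreflexive e, (0 < n)%N,
      forall x y, connect e x y
    & forall c : seq 'I_n, (2 < size c)%N -> ~~ ucycleb e c].

Definition DS (F : fieldType) e (f : {mpoly F[n]}) : {fraction {mpoly F[n]}} :=
  Sym (f%:F / \prod_(p in edges e) ('X_(p.1) - 'X_(p.2))%:F).

Definition del_edge e (p : 'I_n * 'I_n) : rel 'I_n :=
  [rel a b | [&& e a b, (a, b) != p & (b, a) != p]].

Definition component e (p : 'I_n * 'I_n) (x : 'I_n) : {set 'I_n} :=
  [set z | connect (del_edge e p) x z].

(* In a tree with total weight -1, exactly one of component e p p.1 and
   component e p p.2 has negative weight. *)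
Definition regular e w (p : 'I_n * 'I_n) : bool :=
  \sum_(z in component e p p.2) w z < 0.

Definition inversive e w (p : 'I_n * 'I_n) : bool := ~~ regular e w p.

(* Exponents of the monomial C; the truncation `|_|%N is harmless since the
   weights are assumed to be at least -1. *)
Definition expnt w : 'X_{1..n} := [multinom `|(w i + 1)%R|%N | i < n].

Definition signC e w : int := (-1) ^+ #|[set p in edges e | inversive e w p]|.

Definition acceptable e w (s : 'S_n) : bool :=
  [forall p in edges e, (s p.1 < s p.2)%N == regular e w p].

End Graph.

(* Main.v *)
(* For m > 0 put V_m = prod_(i < j) (x_j ^ m - x_i ^ m).  Multiplying and dividing
   C / prod (x - y) by suitable factors turns the denominator into V_m, up to
   sign, and DS_T(C) into A_m / V_m, where A_m is the alternating sum over the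
   permutations of a polynomial G_m.  For m = 1 the alternating polynomial A_1 is
   homogeneous of the degree of V_1, hence a scalar multiple of V_1, so that
   DS_T(C) is a constant c; this c is then also the coefficient in A_m of the
   leading monomial of V_m, for every m.

   For m >= n that coefficient can be read off termwise.  The weight k of the
   component of T \ (x, y) containing y is the flow through the edge (x, y) that
   realises C.  In the expansion of G_m, an edge contributes a factor
   x_j ^ (m - 1 - f) * x_i ^ f and a non-edge a factor x_j ^ m or x_i ^ m.
   Summing exponents modulo m over one side of an edge forces f = k modulo m;
   dividing the remaining equations by m leaves the score conditions of a
   transitive tournament, which has exactly one realisation.  It is compatible
   with 0 <= f < m exactly when the permutation is acceptable (after reversing
   the order), and the signs multiply to sign(C). *)

From mathcomp Require Import zify ring.
Require Import Defs.
Set Implicit Arguments.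
Unset Strict Implicit.
Unset Printing Implicit Defensive.
Import Order.TTheory GRing.Theory Num.Theory.
Local Open Scope ring_scope.

(** * Alternating polynomials *)

Lemma sgz_prod (I : Type) (r : seq I) (P : pred I) (f : I -> int) :
  sgz (\prod_(i <- r | P i) f i) = \prod_(i <- r | P i) sgz (f i).
Proof. exact: (big_morph _ (@sgzM int) (@sgz1 int)). Qed.

(** With nodes [0, ..., n - 1] permuted by [s], the Vandermonde determinant gets its sign once from
    the product formula and once from the column permutation. *)
Lemma sign_perm_inversions (n : nat) (s : 'S_n) :
  (-1) ^+ s = \prod_(i < n) \prod_(j < n | (i < j)%N) (-1) ^+ (s j < s i)%N
    :> int.
Proof.
pose a : 'rV[int]_n := \row_j (j : nat)%:Z.
have Va : Vandermonde n (col_perm s a) = col_perm s (Vandermonde n a).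
  by apply/matrixP=> i j; rewrite !mxE.
have := congr1 (fun M => sgz (\det M)) Va.
rewrite /= det_Vandermonde (col_permE s (Vandermonde n a)).
rewrite det_mulmx det_perm odd_permV.
rewrite det_Vandermonde sgzM !sgz_prod.
rewrite [X in _ = X * _]big1 ?mul1r => [|i _]; last first.
  rewrite sgz_prod big1 // => j ij; rewrite !mxE gtr0_sgz //.
  by rewrite subr_gt0 ltz_nat.
rewrite (_ : sgz ((-1) ^+ s) = (-1) ^+ s); last by case: (odd_perm s).
move=> <-; apply: eq_bigr => i _; rewrite sgz_prod; apply: eq_bigr => j ij.
rewrite !mxE; case: ltngtP => [lt|gt|/val_inj/perm_inj eq].
- by rewrite ltr0_sgz // subr_lt0 ltz_nat.
- by rewrite gtr0_sgz // subr_gt0 ltz_nat.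
by rewrite eq ltnn in ij.
Qed.

Section Alternation.

Variables (F : fieldType) (n : nat).
Implicit Types (p : {mpoly F[n]}) (a : 'X_{1..n}) (s t : 'S_n).

Definition staircase (m : nat) : 'X_{1..n} := [multinom (m * i)%N | i < n].

Definition vdm (m : nat) : {mpoly F[n]} :=
  \prod_(i < n) \prod_(j < n | (i < j)%N) ('X_j ^+ m - 'X_i ^+ m).

Definition alt p : {mpoly F[n]} := \sum_(s : 'S_n) (-1) ^+ s *: msym s p.

Lemma vdm_alt (m : nat) : vdm m = alt 'X_[staircase m].
Proof.
have := det_Vandermonde (\row_j ('X_j ^+ m : {mpoly F[n]})).
under eq_bigr do under eq_bigr do rewrite !mxE.
rewrite -/(vdm m) => <-; apply: eq_bigr => s _.
rewrite -[RHS]mul_mpolyC rmorph_sign; congr (_ * _).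
rewrite msymX (mpolyXE _ s).
by apply: eq_bigr => i _; rewrite !mxE !mnmE permK exprM.
Qed.

Lemma mcoeff_alt p a :
  (alt p)@_a = \sum_(s : 'S_n) (-1) ^+ s * p@_[multinom a (s i) | i < n].
Proof.
rewrite raddf_sum; apply: eq_bigr => s _ /=.
by rewrite mcoeffZ mcoeff_sym.
Qed.

Lemma mcoeff_alt_perm p a t :
  (alt p)@_[multinom a (t i) | i < n] = (-1) ^+ t * (alt p)@_a.
Proof.
rewrite !mcoeff_alt mulr_sumr [RHS](reindex_inj (mulIg t)).
apply: eq_bigr => s _ /=.
rewrite odd_permM signr_addb -mulrA [RHS]mulrCA signrMK.
by congr (_ * p@_ _); apply/mnmP=> i; rewrite !mnmE permM.
Qed.

(** Permutations that differ by the transposition of [i] and [j] cancel in pairs, also in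
    characteristic 2. *)
Lemma mcoeff_alt_repeat p a i j : i != j -> a i = a j -> (alt p)@_a = 0.
Proof.
move=> nij aij; rewrite mcoeff_alt.
rewrite (bigID (@odd_perm _)) /= addrC; apply/eqP; rewrite addr_eq0; apply/eqP.
rewrite -sumrN (reindex_inj (mulIg (tperm i j))) /=; apply: eq_big => s.
  by rewrite odd_permM odd_tperm nij addbT negbK.
rewrite odd_permM odd_tperm nij addbT negbK.
move=> ->; rewrite expr0 expr1 mul1r mulN1r opprK; congr (p@_ _).
apply/mnmP=> k; rewrite !mnmE permM.
by case: tpermP => // ->.
Qed.

Lemma mcoeff_vdm (m : nat) : (0 < m)%N -> (vdm m)@_(staircase m) = 1.
Proof.
move=> m0; rewrite vdm_alt mcoeff_alt (bigD1 (1%g : 'S_n)) //= big1 => [|s s1].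
  rewrite odd_perm1 expr0 mul1r addr0 mcoeffX.
  rewrite (_ : [multinom _ | _ < _] = staircase m) ?eqxx //.
  by apply/mnmP=> i; rewrite !mnmE perm1.
rewrite mcoeffX; case: eqP => [/mnmP E|_]; last by rewrite mulr0.
case/eqP: s1; apply/permP=> i; rewrite perm1; apply/val_inj/eqP.
by move: (E i); rewrite !mnmE => /eqP; rewrite eqn_pmul2l // eq_sym.
Qed.

Lemma vdm_neq0 (m : nat) : (0 < m)%N -> vdm m != 0.
Proof.
move=> m0; apply/eqP=> V0; have := mcoeff_vdm m0.
by rewrite V0 mcoeff0 => /esym/eqP; rewrite oner_eq0.
Qed.

Lemma msym_vdm (m : nat) s : msym s (vdm m) = (-1) ^+ s *: vdm m.
Proof.
rewrite vdm_alt; apply/mpolyP=> a.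
by rewrite mcoeff_sym mcoeff_alt_perm mcoeffZ.
Qed.

Lemma mcoeff_alt_homog d p a :
  p \is d.-homog -> mdeg a != d -> (alt p)@_a = 0.
Proof.
move=> hp da; rewrite mcoeff_alt big1 // => s _.
by rewrite (dhomog_nemf_coeff hp) ?mulr0 //= mdeg_mperm.
Qed.

(** Once sorted, distinct naturals dominate [0, 1, 2, ...] termwise, so equal sums force equality in
    every term. *)
Lemma inj_sum_lt (a : 'I_n -> nat) :
  injective a -> (\sum_i a i = \sum_(i < n) i)%N -> forall i, (a i < n)%N.
Proof.
move=> inja suma.
pose t := sort leq (codom a).
have ut : uniq t by rewrite sort_uniq; apply/injectiveP.
have st : size t = n by rewrite size_sort size_codom card_ord.
have lt : sorted ltn t.
  by rewrite ltn_sorted_uniq_leq ut sort_sorted //; exact: leq_total.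
have ge i : (i < n)%N -> (i <= nth 0 t i)%N.
  elim: i => // i IH lin; apply: leq_ltn_trans (IH (ltnW lin)) _.
  by apply: (sortedP 0 lt); rewrite st.
have sumt : (\sum_(i < n) nth 0 t i = \sum_(i < n) i)%N.
  rewrite -suma -[RHS]big_enum -[RHS](big_map a xpredT id) -/(codom a).
  rewrite -(perm_big _ (permEl (perm_sort leq (codom a)))) /=.
  by rewrite (big_nth 0) -/t st big_mkord.
have tE i : (i < n)%N -> nth 0 t i = i.
  move=> lin.
  have /leqif_sum :=
    (fun (i : 'I_n) (_ : xpredT i) => leqif_eq (ge i (ltn_ord i))).
  rewrite sumt => -[_]; rewrite eqxx => /esym/forallP/(_ (Ordinal lin)) /=.
  by move/eqP.
move=> i; have : a i \in t by rewrite mem_sort codom_f.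
by case/(nthP 0) => k; rewrite st => kn <-; rewrite tE.
Qed.

(** In this degree an exponent without repeated entries is a rearrangement of [staircase 1], so a
    single coefficient determines all others. *)
Lemma alt_vdm p : p \is (\sum_(i < n) i)%N.-homog ->
  alt p = (alt p)@_(staircase 1) *: vdm 1.
Proof.
move=> hp; apply/mpolyP=> a; rewrite mcoeffZ.
have degS : mdeg (staircase 1) = (\sum_(i < n) i)%N.
  by rewrite mdegE; apply: eq_bigr => i _; rewrite mnmE mul1n.
have hS : 'X_[F, staircase 1] \is (\sum_(i < n) i)%N.-homog.
  by rewrite dhomogX /= degS.
case: (mdeg a =P (\sum_(i < n) i)%N) => [da|/eqP da]; last first.
  by rewrite vdm_alt (mcoeff_alt_homog hp) // (mcoeff_alt_homog hS) // mulr0.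
case: (boolP (injectiveb a)) => [/injectiveP inja|/injectivePn[i [j nij aij]]]; last first.
  by rewrite vdm_alt !(mcoeff_alt_repeat _ nij aij) mulr0.
have lt : forall i, (a i < n)%N by apply: inj_sum_lt => //; rewrite -mdegE.
have injo : injective (fun i => Ordinal (lt i)) by move=> i j [/inja].
have -> : a = [multinom (staircase 1) ((perm injo) i) | i < n].
  by apply/mnmP=> i; rewrite !mnmE permE mul1n.
rewrite vdm_alt !mcoeff_alt_perm -vdm_alt mcoeff_vdm //.
by rewrite mulr1 mulrC.
Qed.

End Alternation.

(** * Edge deletion in trees *)

Section Tree.

Variables (n : nat) (e : rel 'I_n).
Hypothesis e_tree : is_tree e.

Let e_sym : ssrbool.symmetric e.
Proof. by case: e_tree. Qed.

Let e_irr : irreflexive e.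
Proof. by case: e_tree. Qed.

Lemma del_edgeC a b : del_edge e (a, b) =2 del_edge e (b, a).
Proof.
move=> x y; rewrite /del_edge /= !xpair_eqE; congr (_ && _).
by rewrite andbC; congr (~~ _ && ~~ _); rewrite andbC.
Qed.

Lemma componentC a b x : component e (a, b) x = component e (b, a) x.
Proof. by apply/setP=> z; rewrite !inE (eq_connect (del_edgeC a b)). Qed.

Lemma del_edge_sym p : ssrbool.symmetric (del_edge e p).
Proof. by move=> x y; rewrite /del_edge /= e_sym; congr (_ && _); rewrite andbC. Qed.

Lemma connect_del_edgeC p : connect_sym (del_edge e p).
Proof. exact/sym_connect_sym/del_edge_sym. Qed.

(** A simple path avoiding the edge would close up with it to a cycle; lengths 0 and 1 give a loop
    and the deleted edge itself. *)
Lemma bridge a b : e a b -> ~~ connect (del_edge e (a, b)) a b.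
Proof.
move=> eab; apply/negP=> /connectP[p0 ep0]; case/shortenP: ep0 => p ep up _ lastb.
have [_ _ _ _ /(_ (a :: p))] := e_tree.
have epe : path e a p by apply: sub_path ep => x y /andP[].
have -> /= : ucycleb e (a :: p).
  by rewrite /ucycleb up andbT /= rcons_path epe -lastb e_sym.
case: p {epe up} ep lastb => [|c [|d p]] /=.
- by move=> _ E; rewrite E e_irr in eab.
- by move=> /andP[/and3P[_ + _] _] E; rewrite E eqxx.
by move=> _ _ /(_ isT).
Qed.

Lemma component_closed p x y z : e x y -> (x, y) != p -> (y, x) != p ->
  (x \in component e p z) = (y \in component e p z).
Proof.
move=> exy nxy nyx; rewrite !inE.
by apply: same_connect_r; [exact: connect_del_edgeC | apply: connect1; apply/and3P].
Qed.

Lemma component_edge a b : e a b ->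
  component e (a, b) b = ~: component e (a, b) a.
Proof.
move=> eab; apply/setP=> z; rewrite in_setC.
have dis : ~~ ((z \in component e (a, b) a) && (z \in component e (a, b) b)).
  apply/negP; rewrite !inE => /andP[az bz]; have /negP := bridge eab; apply.
  by apply: connect_trans az _; rewrite connect_del_edgeC.
suff: (z \in component e (a, b) a) || (z \in component e (a, b) b).
  by case: (z \in _) dis => /=; [move/negbTE=> -> | move=> _ ->].
have: connect e a z by case: e_tree.
case/connectP=> p; elim/last_ind: p z {dis} => [|p y IH] z /=.
  by move=> _ ->; rewrite inE connect0.
rewrite rcons_path last_rcons => /andP[ep ey ->].
have := IH _ ep erefl; move: (last a p) ey => x exy.
case: (altP ((x, y) =P (a, b))) => [[_ ->]|n1]; first by rewrite !inE connect0 orbT.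
case: (altP ((y, x) =P (a, b))) => [[-> _]|n2]; first by rewrite !inE connect0.
by rewrite !(component_closed _ exy n1 n2).
Qed.

Lemma component_avoids v q z : e q v -> z \in component e (q, v) q ->
  connect ([rel x y | [&& e x y, x != v & y != v]]) q z.
Proof.
move=> eqv; rewrite inE => /connectP[p ep ->]; apply/connectP; exists p => //.
apply: (sub_in_path (P := mem (component e (q, v) q))) (ep).
  move=> x y xC yC /= /and3P[-> _ _] /=.
  have nv u : u \in component e (q, v) q -> u != v.
    by apply: contraTneq => ->; rewrite inE bridge.
  by rewrite !nv.
apply/allP=> x xp; suff: x \in component e (q, v) q by [].
by rewrite inE; exact: (path_connect ep).
Qed.

(** Otherwise a walk from [q] through [z] to [q'] and along its edge to [v] would bypass the bridge
    between [q] and [v]. *)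
Lemma component_uniq v q q' z : e q v -> e q' v ->
  z \in component e (q, v) q -> z \in component e (q', v) q' -> q = q'.
Proof.
move=> eqv eq'v zq zq'; apply/eqP/negPn/negP=> nqq'.
have /negP := bridge eqv; apply.
move: zq; rewrite inE => /connect_trans; apply.
rewrite connect_del_edgeC; apply: (@connect_trans _ _ q').
  apply: connect1; apply/and3P; split; first by rewrite e_sym.
    by apply/eqP=> -[Eq _]; rewrite -Eq e_irr in eqv.
  by rewrite xpair_eqE eqxx andbT eq_sym.
apply: connect_sub (component_avoids eq'v zq') => x y /= /and3P[exy xv yv].
apply: connect1; apply/and3P; split=> //.
  by rewrite xpair_eqE (negbTE yv) andbF.
by rewrite xpair_eqE (negbTE xv) andbF.
Qed.

Lemma component_exists v z : z != v ->
  exists2 q, e q v & z \in component e (q, v) q.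
Proof.
move=> zv; have: connect e v z by case: e_tree.
case/connectP=> p0 ep0; case/shortenP: ep0 => p ep up _ zE.
case: p ep up zE => [|q p] /=; first by move=> _ _ E; rewrite E eqxx in zv.
move=> /andP[evq ep] /andP[vp _] zE; exists q; first by rewrite e_sym.
rewrite inE zE; apply/connectP; exists p => //.
apply: (sub_in_path (P := predC1 v)) ep.
  move=> x y; rewrite !inE /= => xv yv exy.
  by rewrite /del_edge /= exy !xpair_eqE (negbTE xv) (negbTE yv) !andbF.
by apply/allP=> x xp; apply: contraNneq vp => <-.
Qed.

Variable w : 'I_n -> int.

Definition side (a b : 'I_n) : int := \sum_(z in component e (a, b) a) w z.

Lemma side_edge a b : e a b -> side a b + side b a = \sum_z w z.
Proof.
move=> eab; rewrite /side (componentC b a) component_edge //.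
rewrite (bigID (mem (component e (a, b) a)) xpredT) /=.
by congr (_ + _); apply: eq_bigl => z; rewrite in_setC.
Qed.

(** The components hanging off [v] partition the other vertices. *)
Lemma sum_side v : \sum_(q | e q v) side q v = \sum_(z | z != v) w z.
Proof.
rewrite (exchange_big_dep (fun z => z != v)) /=; last first.
  by move=> q z eqv; apply: contraTneq => ->; rewrite inE bridge.
apply: eq_bigr => z zv; have [q eqv zq] := component_exists zv.
rewrite (bigD1 q) ?eqv //= big1 ?addr0 // => q' /andP[/andP[eq'v zq']].
by rewrite (component_uniq eqv eq'v zq zq') eqxx.
Qed.

Hypothesis w_total : \sum_z w z = -1.

(** Flow conservation: [side v q + 1] equals [- side q v], so the exponent of [v] is spread over the
    edges at [v]. *)
Lemma sum_side_out v : \sum_(q | e v q) (side v q + 1) = w v + 1.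
Proof.
rewrite (eq_bigl (e^~ v)) => [|q]; last exact: e_sym.
rewrite (eq_bigr (fun q => - side q v)) => [|q /side_edge]; last first.
  by rewrite w_total; lia.
by rewrite sumrN sum_side -[1]opprK -w_total [in RHS](bigD1 v) //= opprD addNKr.
Qed.

End Tree.
(** * Transitive tournaments *)

Section Tournament.

Variable n : nat.
Implicit Types (p : 'I_n * 'I_n) (v : 'I_n).

Lemma sum_incident v (g : 'I_n -> 'I_n -> int) :
  \sum_(q | q != v) g v q =
  \sum_(p : 'I_n * 'I_n | (p.1 < p.2)%N)
    ((v == p.1)%:Z * g p.1 p.2 + (v == p.2)%:Z * g p.2 p.1).
Proof.
rewrite big_split /= (bigID (fun q : 'I_n => (v < q)%N)) /=; congr (_ + _).
  rewrite -(pair_big_dep xpredT (fun i j : 'I_n => (i < j)%N)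
    (fun i j => (v == i)%:Z * g i j)) /=.
  rewrite [RHS](bigD1 v) //= [X in _ + X]big1 ?addr0.
    apply: eq_big => [q|q _]; last by rewrite eqxx mul1r.
    by rewrite andb_idl // => vq; rewrite neq_ltn vq orbT.
  by move=> i; rewrite eq_sym => /negbTE vi; apply: big1 => j _; rewrite vi mul0r.
rewrite -(pair_big_dep xpredT (fun i j : 'I_n => (i < j)%N)
    (fun i j => (v == j)%:Z * g j i)) /= [RHS](exchange_big_dep xpredT) //=.
rewrite [RHS](bigD1 v) //= [X in _ + X]big1 ?addr0.
  apply: eq_big => [q|q _]; last by rewrite eqxx mul1r.
  by rewrite -leqNgt ltn_neqAle.
by move=> i; rewrite eq_sym => /negbTE vi; apply: big1 => j _; rewrite vi mul0r.
Qed.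

Variables (s : 'S_n) (m : int).

(** Each pair hands out [m] units, [d p] to its smaller vertex and the rest to its larger one; [s v]
    is the score of [v] in multiples of [m]. *)
Definition balanced (d : 'I_n * 'I_n -> int) :=
  forall v, \sum_(p : 'I_n * 'I_n | (p.1 < p.2)%N)
    ((v == p.1)%:Z * d p + (v == p.2)%:Z * (m - d p)) = m * (s v)%:Z.

Lemma balanced_sum d (c : 'I_n -> int) : balanced d ->
  \sum_(p : 'I_n * 'I_n | (p.1 < p.2)%N) (c p.1 * d p + c p.2 * (m - d p)) =
  m * \sum_v c v * (s v)%:Z.
Proof.
move=> bal; rewrite mulr_sumr.
under [RHS]eq_bigr do rewrite mulrCA -bal mulr_sumr.
rewrite exchange_big /=; apply: eq_bigr => p _.
under eq_bigr do rewrite mulrDr.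
rewrite big_split /= (bigD1 p.1) //= eqxx mul1r [X in _ + X + _]big1 ?addr0.
  rewrite (bigD1 p.2) //= eqxx mul1r [X in _ + (_ + X)]big1 ?addr0 //.
  by move=> v /negbTE ->; rewrite mul0r mulr0.
by move=> v /negbTE ->; rewrite mul0r mulr0.
Qed.

Definition dominance p : int := (s p.2 < s p.1)%N%:Z * m.

(** Exactly [s v] vertices are ranked below [v] by [s]. *)
Lemma balanced_dominance : balanced dominance.
Proof.
move=> v.
transitivity (\sum_(q | q != v) (s q < s v)%N%:Z * m).
  rewrite (sum_incident v (fun v q => (s q < s v)%N%:Z * m)).
  apply: eq_bigr => p lp; congr (_ + _ * _); rewrite /dominance.
  case: ltngtP => [_|_|/val_inj/perm_inj E]; try by lia.
  by rewrite E ltnn in lp.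
rewrite -mulr_suml mulrC; congr (_ * _).
transitivity (\sum_q (s q < s v)%N%:Z).
  by rewrite [RHS](bigD1 v) //= ltnn add0r.
rewrite (reindex_inj (@perm_inj _ s^-1)) /=.
under eq_bigr do rewrite permKV.
transitivity (\sum_(i < n) (i < s v)%N)%N%:Z.
  by rewrite raddf_sum; apply: eq_bigr => i _.
congr (_%:Z); transitivity (\sum_(i < s v) 1)%N; last first.
  by rewrite sum1_card card_ord.
rewrite (big_ord_widen n (fun=> 1%N)) ?[RHS]big_mkcond.
  by apply: eq_bigr => i _; case: ltnP.
exact: ltnW.
Qed.

(* Testing the balance conditions against the weights [s v] shows that a
   choice of winners with the scores of a transitive tournament is maximal,
   hence is that tournament. *)
Lemma balanced_unique d : 0 < m -> balanced d ->
  (forall p, (p.1 < p.2)%N -> d p = 0 \/ d p = m) ->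
  forall p, (p.1 < p.2)%N -> d p = dominance p.
Proof.
move=> m0 bal d01.
have := balanced_sum (fun v => (s v)%:Z) bal.
rewrite -(balanced_sum (fun v => (s v)%:Z) balanced_dominance) => E.
have term p : (p.1 < p.2)%N ->
  (s p.1)%:Z * d p + (s p.2)%:Z * (m - d p) <=
  (s p.1)%:Z * dominance p + (s p.2)%:Z * (m - dominance p)
    ?= iff (d p == dominance p).
  move=> lp; have nE : s p.1 != s p.2 :> nat.
    by apply/eqP=> /val_inj/perm_inj E'; rewrite E' ltnn in lp.
  rewrite /dominance; apply/leifP; case: eqP => [->//|].
  by case: (ltngtP (s p.2) (s p.1)) nE => // lt _; case: (d01 p lp) => -> //;
    rewrite ?mul1r ?mul0r // => _; nia.
have /= := leif_sum term.
rewrite E => -[_]; rewrite eqxx => /esym/forall_inP H p lp.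
exact/eqP/H.
Qed.

End Tournament.
(** * Flows on the tree *)

Section Flow.

Variables (n : nat) (e : rel 'I_n) (w : 'I_n -> int).
Hypotheses (e_tree : is_tree e) (w_ge : forall x, -1 <= w x).
Hypothesis w_total : \sum_z w z = -1.
Implicit Types (p : 'I_n * 'I_n) (v : 'I_n) (s : 'S_n).

(* Sum the balance conditions over one side of an edge: modulo [m] only that
   edge contributes. *)
Lemma balanced_dvd s (m : int) (d : 'I_n * 'I_n -> int) : balanced s m d ->
  (forall p, (p.1 < p.2)%N -> ~~ e p.1 p.2 -> (m %| d p)%Z) ->
  forall p, (p.1 < p.2)%N -> (m %| d p)%Z.
Proof.
move=> bal dn p lp; case: (boolP (e p.1 p.2)) => [ep|]; last exact: dn.
have := balanced_sum (fun v => (v \in component e p p.1)%:Z) bal.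
rewrite (bigD1 p) //= => /(congr1 (fun x => m %| x)%Z).
rewrite [in RHS]dvdz_mulr ?dvdzz // rpredDr.
  have -> : p.1 \in component e p p.1 by rewrite inE connect0.
  have /negbTE -> : p.2 \notin component e p p.1.
    by rewrite inE; case: (p) ep => a b; exact: bridge.
  by rewrite mul1r mul0r addr0.
apply: rpred_sum => q /andP[lq nqp].
case: (boolP (e q.1 q.2)) => [eq|/(dn _ lq) dq].
  rewrite (component_closed e_tree _ eq).
  - by rewrite -mulrDr addrC subrK dvdz_mull.
  - by rewrite -surjective_pairing.
  by apply: contraTneq lp => <-; rewrite -leqNgt ltnW.
by rewrite rpredD // dvdz_mull // rpredB // dvdzz.
Qed.

(** Each of at most [n] vertices weighs at least [-1]; applied to the opposite side of an edge, this
    also bounds the flow from above. *)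
Lemma side_ge a b : - n%:Z <= side e w a b.
Proof.
apply: (@le_trans _ _ (\sum_(z in component e (a, b) a) -1)).
  rewrite sumr_const mulNrn lerN2 natz lez_nat.
  by rewrite -[X in (_ <= X)%N](card_ord n) max_card.
exact: ler_sum.
Qed.

Lemma side_lt a b : e a b -> side e w a b < n%:Z.
Proof.
by move=> eab; have := side_edge e_tree w eab; have := side_ge b a; lia.
Qed.

Lemma regular_side p : regular e w p = (side e w p.2 p.1 < 0).
Proof. by case: p => a b; rewrite /regular /side componentC. Qed.

(* The deviation of the exponents [f] from the flow determined by [w]. *)
Definition excess (f : 'I_n * 'I_n -> nat) p : int :=
  (f p)%:Z - (e p.1 p.2)%:Z * side e w p.2 p.1.

(** At an edge, [sum_side_out] turns the shares [f p] and [m - 1 - f p] into [excess f p] and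
    [m - excess f p]. The bound on [f] keeps the natural subtractions from truncating. *)
Lemma expnt_balance (m : nat) (f : 'I_n * 'I_n -> nat) v :
  (forall p, (p.1 < p.2)%N -> (f p + e p.1 p.2 <= m)%N) ->
  (expnt w v + \sum_(p : 'I_n * 'I_n | (p.1 < p.2)%N)
     ((p.2 == v) * (m - e p.1 p.2 - f p) + (p.1 == v) * f p))%N%:Z =
  \sum_(p : 'I_n * 'I_n | (p.1 < p.2)%N)
     ((v == p.1)%:Z * excess f p + (v == p.2)%:Z * (m%:Z - excess f p)).
Proof.
move=> fm; rewrite PoszD raddf_sum mnmE.
have -> : `|(w v + 1)%R|%N%:Z = w v + 1 by have := w_ge v; lia.
rewrite -(sum_side_out e_tree w_total) big_mkcond.
rewrite [LHS](_ : _ = \sum_(q | q != v) (e v q)%:Z * (side e w v q + 1)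
    + \sum_(p : 'I_n * 'I_n | (p.1 < p.2)%N)
     ((p.2 == v) * (m - e p.1 p.2 - f p) + (p.1 == v) * f p)%N%:Z); last first.
  congr (_ + _); rewrite [LHS](bigD1 v) //=; have [_ -> _ _ _] := e_tree.
  by rewrite add0r; apply: eq_bigr => q _; case: e; rewrite ?mul1r ?mul0r.
rewrite (sum_incident v (fun v q => (e v q)%:Z * (side e w v q + 1))).
rewrite -big_split /=; apply: eq_bigr => p lp; rewrite /excess.
have := fm p lp; have [-> _ _ _ _] := e_tree; rewrite ![v == _]eq_sym.
case: (boolP (e p.2 p.1)) => [/(side_edge e_tree w)|_] /=.
  by rewrite w_total; do 2![case: eqP => _]; lia.
by do 2![case: eqP => _]; lia.
Qed.

(* [acceptable] for the reversed order: the leading monomial [staircase] gives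
   larger variables larger exponents. *)
Definition accepts s :=
  [forall p in edges e, (s p.2 < s p.1)%N == regular e w p].

Variable m : nat.
Hypothesis n_le_m : (n <= m)%N.

Definition admissible (f : 'I_n * 'I_n -> nat) :=
  forall p, (p.1 < p.2)%N ->
    if e p.1 p.2 then (f p < m)%N else (f p == 0%N) || (f p == m).

Lemma admissible_dominance s f : admissible f -> balanced s m%:Z (excess f) ->
  forall p, (p.1 < p.2)%N -> excess f p = dominance s m%:Z p.
Proof.
move=> adm bal; have n0 : (0 < n)%N by case: e_tree.
apply: balanced_unique => // [|p lp]; first lia.
have /dvdzP[k] : (m%:Z %| excess f p)%Z.
  apply: balanced_dvd bal _ p lp => p lp ep.
  have := adm p lp; rewrite (negbTE ep) /excess (negbTE ep) mul0r subr0.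
  by case/orP=> /eqP ->; rewrite ?dvdz0 ?dvdzz.
have := adm p lp; rewrite /excess; case: ifP => [ep|_]; last first.
  by rewrite mul0r subr0; case/orP => /eqP ->; [left|right].
have := side_ge p.2 p.1.
have /side_lt : e p.2 p.1 by have [-> _ _ _ _] := e_tree.
rewrite mul1r => h1 h2 h3 E.
(* Since [n <= m], the excess lies strictly between [- m] and [2 m]; being a multiple of [m], it is
   [0] or [m]. *)
have k2 : k < 2 by nia.
have k0 : -1 < k by nia.
have [k_eq|k_eq] : k = 0 \/ k = 1 by lia.
  by left; rewrite E k_eq mul0r.
by right; rewrite E k_eq mul1r.
Qed.

(** At an edge [f p] is the flow, plus [m] if [p.1] wins; the range [0 <= f p < m] ties the winner
    to the sign of the flow. *)
Lemma admissible_accepts s f :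
  admissible f -> balanced s m%:Z (excess f) -> accepts s.
Proof.
move=> adm bal; apply/forall_inP=> p; rewrite inE => /andP[lp ep].
have := admissible_dominance adm bal lp; have := adm p lp.
rewrite /excess /dominance ep regular_side mul1r.
by case: (ltnP (s p.2)) => _ /=; case: ltP; lia.
Qed.

Lemma accepts_solution s : accepts s ->
  exists2 f, admissible f & balanced s m%:Z (excess f).
Proof.
move=> acc.
(* The only candidate, from solving [excess f = dominance] for [f]; acceptance makes it nonnegative,
   so the absolute value changes nothing. *)
pose f p : nat := `|(dominance s m%:Z p + (e p.1 p.2)%:Z * side e w p.2 p.1)%R|%N.
have fE p : (p.1 < p.2)%N -> (f p)%:Z =
    dominance s m%:Z p + (e p.1 p.2)%:Z * side e w p.2 p.1.
  move=> lp; rewrite /f /dominance; case: (boolP (e p.1 p.2)) => ep; last lia.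
  have := side_ge p.2 p.1.
  move/forall_inP/(_ p): acc; rewrite inE lp ep regular_side => /(_ isT)/eqP ->.
  by case: ltP; lia.
exists f => [p lp|v].
  have := fE p lp; rewrite /dominance; case: (boolP (e p.1 p.2)) => ep; last first.
    by case: ltnP => _ E; lia.
  move/forall_inP/(_ p): acc; rewrite inE lp ep regular_side => /(_ isT)/eqP ->.
  have /side_lt : e p.2 p.1 by have [-> _ _ _ _] := e_tree.
  by case: ltP; lia.
rewrite -[RHS]balanced_dominance; apply: eq_bigr => p lp.
by rewrite /excess fE // addrK.
Qed.

End Flow.
(** * Extraction of the coefficient *)

Section Cofactor.

Variables (F : fieldType) (n : nat) (e : rel 'I_n) (m : nat).
Hypothesis m_gt0 : (0 < m)%N.
Implicit Types (p : 'I_n * 'I_n) (s : 'S_n).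

(** At an edge, this is the quotient of ['X_(p.2) ^+ m - 'X_(p.1) ^+ m] by ['X_(p.2) - 'X_(p.1)]. *)
Definition cofactor p : {mpoly F[n]} :=
  if e p.1 p.2 then \sum_(k < m) 'X_(p.2) ^+ (m.-1 - k) * 'X_(p.1) ^+ k
  else 'X_(p.2) ^+ m - 'X_(p.1) ^+ m.

Definition edge_diffs : {mpoly F[n]} :=
  \prod_(p in edges e) ('X_(p.1) - 'X_(p.2)).

Lemma prod_cofactor :
  edge_diffs * \prod_(p : 'I_n * 'I_n | (p.1 < p.2)%N) cofactor p =
  (-1) ^+ #|edges e| * vdm F n m.
Proof.
rewrite /edge_diffs; under eq_bigr do rewrite -opprB.
rewrite prodrN -mulrA; congr (_ * _).
rewrite /vdm pair_big_dep /= (eq_bigl (fun p => (p.1 < p.2)%N && e p.1 p.2)).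
  rewrite big_mkcondr -big_split /=; apply: eq_bigr => p _.
  by rewrite /cofactor; case: ifP => _; rewrite ?mul1r // -subrXX.
by move=> p; rewrite inE.
Qed.

(* At an edge, [k = m] is a dummy index with coefficient [0]; it lets edges and
   non-edges share the index type ['I_m.+1]. *)
Definition cofactor_coef p (k : nat) : F :=
  if e p.1 p.2 then (k < m)%N%:R else (k == 0%N)%:R - (k == m)%:R.

(** At an edge the degree drops to [m - 1]; there the subtraction truncates only at the dummy index
    [k = m]. *)
Definition cofactor_mon p (k : nat) : 'X_{1..n} :=
  (U_(p.2) *+ (m - e p.1 p.2 - k) + U_(p.1) *+ k)%MM.

Lemma cofactorE p :
  cofactor p =
  \sum_(k < m.+1) cofactor_coef p k *: 'X_[cofactor_mon p k].
Proof.
rewrite /cofactor /cofactor_coef /cofactor_mon.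
under [RHS]eq_bigr do rewrite mpolyXD -!mpolyXn.
case: ifP => _ /=.
  rewrite [RHS]big_ord_recr /= ltnn scale0r addr0; apply: eq_bigr => k _.
  by rewrite ltn_ord scale1r subn1.
rewrite [RHS]big_ord_recr /= eqxx (negbTE (lt0n_neq0 m_gt0)) sub0r scaleN1r.
rewrite !subn0 subnn expr0 mul1r; congr (_ - _).
rewrite (bigD1 (Ordinal m_gt0)) //= big1 ?addr0 => [|k].
  by rewrite eq_sym (negbTE (lt0n_neq0 m_gt0)) subr0 scale1r subn0 expr0 mulr1.
rewrite -val_eqE /= => /negbTE ->.
by rewrite (ltn_eqF (ltn_ord k)) subr0 scale0r.
Qed.

(** Each [f] picks one term from every factor; the default [ord0] off the increasing pairs makes
    every choice occur once. *)
Lemma mcoeff_cofactors (c a : 'X_{1..n}) :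
  ('X_[c] * \prod_(p : 'I_n * 'I_n | (p.1 < p.2)%N) cofactor p)@_a =
  \sum_(f in pffun_on (ord0 : 'I_m.+1) (fun p => (p.1 < p.2)%N) predT)
    (\prod_(p : 'I_n * 'I_n | (p.1 < p.2)%N) cofactor_coef p (f p)) *
    ((c + \sum_(p : 'I_n * 'I_n | (p.1 < p.2)%N) cofactor_mon p (f p))%MM
       == a)%:R.
Proof.
under eq_bigr do rewrite cofactorE.
rewrite (big_distr_big ord0) mulr_sumr raddf_sum; apply: eq_bigr => f _ /=.
rewrite scaler_prod -scalerAr mcoeffZ -mcoeffX mpolyXD; congr (_ * (_ * _)@__).
by rewrite (big_morph _ (@mpolyXD n F) (mpolyX0 n F)).
Qed.

End Cofactor.

(** * Matching exponents with balanced flows *)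

Section FlowCoefficient.

Variables (F : fieldType) (n : nat) (e : rel 'I_n) (w : 'I_n -> int).
Hypotheses (e_tree : is_tree e) (w_ge : forall x, -1 <= w x).
Hypothesis w_total : \sum_z w z = -1.
Implicit Types (p : 'I_n * 'I_n) (v : 'I_n) (s : 'S_n).

Lemma expnt_cofactor_mon (m : nat) s (f : 'I_n * 'I_n -> nat) :
  (forall p, (p.1 < p.2)%N -> (f p + e p.1 p.2 <= m)%N) ->
  (expnt w + \sum_(p : 'I_n * 'I_n | (p.1 < p.2)%N) cofactor_mon e m p (f p))%MM
    = [multinom staircase n m (s i) | i < n] <->
  balanced s m%:Z (excess e w f).
Proof.
move=> fm.
have E v : ((expnt w + \sum_(p : 'I_n * 'I_n | (p.1 < p.2)%N)
    cofactor_mon e m p (f p))%MM v)%:Z =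
  \sum_(p : 'I_n * 'I_n | (p.1 < p.2)%N)
    ((v == p.1)%:Z * excess e w f p + (v == p.2)%:Z * (m%:Z - excess e w f p)).
  rewrite -expnt_balance // mnmDE mnm_sumE; congr (_ + _)%N%:Z.
  by apply: eq_bigr => p _; rewrite mnmDE !mulmnE !mnm1E.
split=> [/mnmP H v|bal]; first by rewrite -E H !mnmE PoszM.
apply/mnmP=> v; have := E v; rewrite (bal v) -PoszM => -[->].
by rewrite !mnmE.
Qed.

Variable m : nat.
Hypothesis n_le_m : (n <= m)%N.

Let m_gt0 : (0 < m)%N.
Proof. by apply: leq_trans n_le_m; case: e_tree. Qed.

(** A single [f] contributes. Its coefficient is [1] at edges; at a non-edge it is [-1] exactly when
    [p.1] wins, which selects [- 'X_(p.1) ^+ m]. *)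
Lemma mcoeff_expnt_cofactors s :
  ('X_[expnt w] * \prod_(p : 'I_n * 'I_n | (p.1 < p.2)%N) cofactor F e m p)
    @_[multinom staircase n m (s i) | i < n] =
  if accepts e w s then
    \prod_(p : 'I_n * 'I_n | (p.1 < p.2)%N && ~~ e p.1 p.2)
      (-1) ^+ (s p.2 < s p.1)%N
  else 0.
Proof.
pose P p := (p.1 < p.2)%N.
have adm_le f : admissible e m f -> forall p, P p -> (f p + e p.1 p.2 <= m)%N.
  move=> adm p /adm; case: ifP => _ /=; first by rewrite addn1.
  by rewrite addn0 => /orP[] /eqP ->.
have supp (f : {ffun 'I_n * 'I_n -> 'I_m.+1}) :
    ~ (admissible e m (fun p => f p) /\
       balanced s m%:Z (excess e w (fun p => f p))) ->
    (\prod_(p | P p) cofactor_coef F e m p (f p)) *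
    ((expnt w + \sum_(p | P p) cofactor_mon e m p (f p))%MM
       == [multinom staircase n m (s i) | i < n])%:R = 0.
  move=> nsol; apply/eqP; rewrite mulf_eq0 -implyNb; apply/implyP.
  move/prodf_neq0=> nz.
  have adm : admissible e m (fun p => f p).
    move=> p lp; have := nz p lp; rewrite /cofactor_coef.
    case: ifP => _; first by case: ltnP => //; rewrite eqxx.
    by case: (_ == 0%N) => //; case: (_ == m) => //; rewrite subrr eqxx.
  case E: (_ == [multinom _ | _ < _]) => //; case: nsol; split=> //.
  by move/eqP: E => /(expnt_cofactor_mon _ (adm_le _ adm)).
rewrite mcoeff_cofactors //; case: ifP => [acc|nacc]; last first.
  apply: big1 => f _; apply: supp => -[adm bal].
  by rewrite (admissible_accepts e_tree w_ge w_total n_le_m adm bal) in nacc.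
have [f1 adm1 bal1] := accepts_solution e_tree w_ge w_total n_le_m acc.
have f1_le p : P p -> (f1 p < m.+1)%N.
  by move/(adm_le _ adm1) => le; rewrite ltnS (leq_trans _ le) ?leq_addr.
(* [accepts_solution] says nothing off the increasing pairs, where membership in [pffun_on] demands
   [ord0]. *)
pose f0 := [ffun p => if P p then inord (f1 p) else ord0 : 'I_m.+1].
have f0E p : P p -> f0 p = f1 p :> nat.
  by move=> lp; rewrite ffunE lp inordK ?f1_le.
have exc0 p : P p -> excess e w (fun p => f0 p) p = excess e w f1 p.
  by move=> lp; rewrite /excess f0E.
have f0P : f0 \in pffun_on ord0 P predT.
  apply/pffun_onP; split=> //; apply/subsetP=> p; apply: contraLR => lp.
  by rewrite supportE ffunE [P p](negbTE lp) eqxx.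
(* Any other contributing [f] has the same excess, namely [dominance], and so agrees with [f0]. *)
rewrite (bigD1 f0) //= [X in _ + X]big1 ?addr0 => [|f /andP[fP nf]]; last first.
  apply: supp => -[adm bal]; case/eqP: nf; apply/ffunP=> p; apply: val_inj.
  case: (boolP (P p)) => lp /=; last first.
    have /pffun_onP[/supportP H _] := fP; have /pffun_onP[/supportP H0 _] := f0P.
    by rewrite H // H0.
  have := admissible_dominance e_tree w_ge w_total n_le_m adm bal lp.
  rewrite -(admissible_dominance e_tree w_ge w_total n_le_m adm1 bal1 lp).
  by rewrite /excess f0E // => /addIr[].
have -> : ((expnt w + \sum_(p | P p) cofactor_mon e m p (f0 p))%MM
            == [multinom staircase n m (s i) | i < n]) = true.
  apply/eqP/(@expnt_cofactor_mon m s (fun p => f0 p)).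
    by move=> p lp; rewrite f0E ?adm_le.
  move=> v; rewrite -bal1; apply: eq_bigr => p lp; by rewrite exc0.
rewrite mulr1 big_mkcondr; apply: eq_bigr => p lp.
have := admissible_dominance e_tree w_ge w_total n_le_m adm1 bal1 lp.
have := adm1 p lp; rewrite /excess /cofactor_coef f0E //.
case: ifP => [_ -> //|_ _]; rewrite mul0r subr0 /dominance.
have m0 : (m == 0%N) = false by case: (m) m_gt0.
case: (s p.2 < s p.1)%N; rewrite ?mul1r ?mul0r => -[->].
  by rewrite m0 eqxx sub0r expr1.
by rewrite [0%N == m]eq_sym m0 subr0 expr0.
Qed.

End FlowCoefficient.

(** * Divided symmetrization as an alternating quotient *)

Section DividedSymmetrization.

Variables (F : fieldType) (n : nat) (e : rel 'I_n).

(** Applying [s] to [prod_cofactor] brings each summand over the denominator [vdm F n m], whose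
    antisymmetry supplies the sign of [s] in [alt]. *)
Lemma DS_alt (f : {mpoly F[n]}) (m : nat) : (0 < m)%N ->
  DS e f * tofrac (vdm F n m) =
  tofrac ((-1) ^+ #|edges e| *
    alt (f * \prod_(p : 'I_n * 'I_n | (p.1 < p.2)%N) cofactor F e m p)).
Proof.
move=> m0; have V0 := vdm_neq0 F n m0.
have prodE := prod_cofactor F e m.
set Q := \prod_(p | _) _ in prodE *.
have D0 : (edge_diffs F e) != 0.
  apply: contraNneq V0 => E; move: prodE; rewrite E mul0r => /esym/eqP.
  by rewrite mulf_eq0 signr_eq0.
have msym_neq0 s (q : {mpoly F[n]}) : q != 0 -> msym s q != 0.
  by move=> q0; rewrite (raddf_eq0 _ (@inj_msym _ _ s)).
rewrite /DS -rmorph_prod -/(edge_diffs F e) /Sym mulr_suml tofracM /alt.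
rewrite rmorph_sum mulr_sumr; apply: eq_bigr => s _.
rewrite subst_frac_div // mulrAC.
apply: (mulIf (_ : tofrac (msym s (edge_diffs F e)) != 0)).
  by rewrite tofrac_eq0 msym_neq0.
rewrite mulfVK ?tofrac_eq0 ?msym_neq0 // -!tofracM.
congr (tofrac _); have := congr1 (msym s) prodE.
rewrite !msymM rmorph_sign msym_vdm -!mul_mpolyC !rmorph_sign => E.
have -> : vdm F n m = (-1) ^+ #|edges e| * (-1) ^+ s *
   (msym s (edge_diffs F e) * msym s Q).
  by rewrite E mulrACA -!expr2 !sqrr_sign mul1r !mulrA -!expr2 ?sqrr_sign !mul1r.
by rewrite [msym s (edge_diffs F e) * _]mulrC mulrCA -!mulrA.
Qed.

(* [m] is arbitrary because the constant can be computed from [m = 1]. *)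
Lemma DS_const (c : 'X_{1..n}) (m : nat) : (0 < m)%N ->
  (mdeg c + \sum_(p : 'I_n * 'I_n | (p.1 < p.2)%N) ~~ e p.1 p.2 =
   \sum_(i < n) i)%N ->
  DS e ('X_[F, c]) = tofrac (((-1) ^+ #|edges e| *
    (alt ('X_[c] * \prod_(p : 'I_n * 'I_n | (p.1 < p.2)%N) cofactor F e m p))
      @_(staircase n m))%:MP).
Proof.
move=> m0 degc.
have hom : 'X_[c] * \prod_(p : 'I_n * 'I_n | (p.1 < p.2)%N) cofactor F e 1 p
   \is (\sum_(i < n) i)%N.-homog.
  rewrite -degc; apply: dhomogM; first by rewrite dhomogX.
  apply: (big_ind2 (fun (q : {mpoly F[n]}) (d : nat) => q \is d.-homog)).
  - exact: dhomog1.
  - by move=> q1 d1 q2 d2; apply: dhomogM.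
  move=> p _; rewrite /cofactor; case: ifP => _ /=.
    by rewrite big_ord1 !expr0 mulr1; apply: dhomog1.
  by rewrite !expr1; apply: rpredB; rewrite dhomogX /= mdeg1.
have [k DSE] : exists k : F, DS e 'X_[F, c] = tofrac k%:MP.
  have := DS_alt 'X_[c] (ltn0Sn 0); rewrite (alt_vdm hom) => E.
  exists ((-1) ^+ #|edges e| * (alt ('X_[c] *
    \prod_(p : 'I_n * 'I_n | (p.1 < p.2)%N) cofactor F e 1 p))@_(staircase n 1)).
  apply: (mulIf (_ : tofrac (vdm F n 1) != 0)).
    by rewrite tofrac_eq0 vdm_neq0.
  rewrite E -[RHS]tofracM -mul_mpolyC mulrA mpolyCM.
  by rewrite (rmorph_sign (@mpolyC n F)).
have := DS_alt 'X_[c] m0; rewrite DSE -tofracM => /eqP; rewrite tofrac_eq => /eqP.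
(* At this exponent [vdm F n m] has coefficient [1], which isolates the constant. *)
move/(congr1 (mcoeff (staircase n m))).
rewrite mul_mpolyC mcoeffZ mcoeff_vdm // mulr1 => ->.
by rewrite -(rmorph_sign (@mpolyC n F)) mul_mpolyC mcoeffZ.
Qed.

End DividedSymmetrization.

(** * Degrees, signs and order reversal *)

Section Counting.

Variables (F : fieldType) (n : nat) (e : rel 'I_n) (w : 'I_n -> int).
Hypotheses (e_tree : is_tree e) (w_ge : forall x, -1 <= w x).

Lemma sum_weight : mdeg (expnt w) = n.-1 -> \sum_z w z = -1.
Proof.
move=> degC; have n0 : (0 < n)%N by case: e_tree.
have : \sum_z (w z + 1) = n.-1%:Z.
  rewrite -degC mdegE raddf_sum; apply: eq_bigr => z _ /=.
  by rewrite mnmE; have := w_ge z; lia.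
rewrite big_split /= sumr_const card_ord natz => E.
by apply: (addIr n%:Z); rewrite E; lia.
Qed.

Lemma sum_pairs : (\sum_(p : 'I_n * 'I_n | (p.1 < p.2)%N) 1 = \sum_(i < n) i)%N.
Proof.
rewrite -(pair_big_dep xpredT (fun i j : 'I_n => (i < j)%N) (fun _ _ => 1%N)) /=.
rewrite (exchange_big_dep xpredT) //=; apply: eq_bigr => j _.
rewrite -(big_ord_widen n (fun=> 1%N) (ltnW (ltn_ord j))).
by rewrite sum1_card card_ord.
Qed.

(** Summing [expnt_balance] for [m = 1], [f = 0] over all vertices gives [1] per pair, which avoids
    counting the edges of the tree. *)
Lemma deg_nonedges : \sum_z w z = -1 ->
  (mdeg (expnt w) + \sum_(p : 'I_n * 'I_n | (p.1 < p.2)%N) ~~ e p.1 p.2 =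
   \sum_(i < n) i)%N.
Proof.
move=> wt; rewrite -sum_pairs; apply/eqP; rewrite -eqz_nat; apply/eqP.
have le1 (p : 'I_n * 'I_n) : (p.1 < p.2)%N -> (0 + e p.1 p.2 <= 1)%N.
  by case: (e p.1 p.2).
have bal v := @expnt_balance n e w e_tree w_ge wt 1 (fun=> 0%N) v le1.
transitivity (\sum_v (expnt w v + \sum_(p : 'I_n * 'I_n | (p.1 < p.2)%N)
     ((p.2 == v) * (1 - e p.1 p.2 - 0) + (p.1 == v) * 0))%N%:Z).
  rewrite -raddf_sum /= big_split /= -mdegE; congr (_ + _)%N%:Z.
  rewrite exchange_big /=; apply: eq_bigr => p lp.
  rewrite (bigD1 p.2) //= eqxx big1 => [|v]; last first.
    by rewrite eq_sym => /negbTE ->; rewrite muln0.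
  by rewrite muln0 !addn0 mul1n subn0; case: e.
rewrite (eq_bigr _ (fun v _ => bal v)) exchange_big raddf_sum /=.
apply: eq_bigr => p lp; rewrite big_split /= -!mulr_suml.
have one (i : 'I_n) : \sum_v (v == i)%:Z = 1.
  by rewrite (bigD1 i) //= eqxx big1 ?addr0 // => v /negbTE ->.
by rewrite !one; ring.
Qed.

(** Inversions at non-edges cancel against the product. At an edge, [-1] meets another [-1] exactly
    when the edge is regular, so inversive edges keep their sign. *)
Lemma sign_accepts (s : 'S_n) : accepts e w s ->
  (-1) ^+ #|edges e| * ((-1) ^+ s *
    \prod_(p : 'I_n * 'I_n | (p.1 < p.2)%N && ~~ e p.1 p.2)
      (-1) ^+ (s p.2 < s p.1)%N) =
  (signC e w)%:~R :> F.
Proof.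
move=> acc.
have -> : (-1) ^+ s = \prod_(p : 'I_n * 'I_n | (p.1 < p.2)%N)
    (-1) ^+ (s p.2 < s p.1)%N :> F.
  rewrite -(rmorph_sign (intr : int -> F)) sign_perm_inversions pair_big_dep /=.
  by rewrite rmorph_prod; apply: eq_bigr => p _; rewrite rmorph_sign.
rewrite (bigID (fun p => e p.1 p.2)) /= -mulrA -big_split /=.
rewrite [X in _ * (_ * X)]big1 ?mulr1 => [|p _]; last by rewrite -expr2 sqrr_sign.
have edgesE (p : 'I_n * 'I_n) : (p \in edges e) = (p.1 < p.2)%N && e p.1 p.2.
  by rewrite inE.
rewrite /signC rmorph_sign -!prodr_const !(eq_bigl _ _ edgesE).
rewrite -big_split /= [RHS](eq_bigl (fun p : 'I_n * 'I_n =>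
  ((p.1 < p.2)%N && e p.1 p.2) && inversive e w p)) => [|p]; last by rewrite !inE.
rewrite [RHS]big_mkcondr; apply: eq_bigr => p lp.
have /eqP-> := forall_inP acc p (etrans (edgesE p) lp).
by rewrite /inversive; case: regular => /=; rewrite ?expr1 ?mulrNN mulr1.
Qed.

(** Composing with the order reversal of the values is a bijection between the two sets. *)
Lemma card_accepts : #|[set s | accepts e w s]| = #|[set s | acceptable e w s]|.
Proof.
pose r := perm (@rev_ord_inj n).
rewrite -[RHS](card_imset _ (mulIg r)); congr #|pred_of_set _|; apply/setP=> s.
rewrite -[s](mulgVK r).
rewrite [RHS](mem_imset _ (s * r^-1)%g (mulIg r)) !inE.
apply: eq_forallb => p; congr (_ ==> (_ == _)).
move: (s * r^-1)%g => t; rewrite !permM !permE /=.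
by case: (t p.1) (t p.2) => [a la] [b lb] /=; lia.
Qed.

End Counting.

Theorem theorem2 (F : fieldType) (n : nat) (e : rel 'I_n) (w : 'I_n -> int)
    (e_tree : is_tree e)
    (w_ge : forall x, -1 <= w x)
    (deg_C : mdeg (expnt w) = n.-1) :
  DS e ('X_[F, expnt w]) =
  (signC e w * #|[set s : 'S_n | acceptable e w s]|%:Z)%:~R.
Proof.
have wt := sum_weight e_tree w_ge deg_C.
have n0 : (0 < n)%N by case: e_tree.
(* Here [m] is [n], the least value for which the coefficient extraction is valid. *)
rewrite (DS_const F n0 (deg_nonedges e_tree w_ge wt)) mcoeff_alt mulr_sumr.
rewrite -card_accepts -natz mulr_natr -sumr_const.
transitivity (tofrac ((\sum_(s in [set s | accepts e w s])
    signC e w)%:~R%:MP : {mpoly F[n]})).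
  congr (tofrac _%:MP); rewrite [RHS]rmorph_sum [RHS]big_mkcond /=.
  apply: eq_bigr => s _.
  rewrite inE (mcoeff_expnt_cofactors F e_tree w_ge wt (leqnn n)).
  by case: ifP => [/sign_accepts->|_]; rewrite ?mulr0.
by rewrite (rmorph_int (@mpolyC n F)) rmorph_int.
Qed.
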